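(* Let $n\ge2$ and let $F\colon\mathbb{R}^{n-1}\to(-\infty,+\infty]$ be proper, lower semicontinuous and $\beta_1$-weakly convex with $\beta_1\ge0$; for every $i\in\{2,\dots,m\}$ let $g_i\colon\mathbb{R}^{n-1}\to(-\infty,+\infty]$ be proper, lower semicontinuous and $\beta_i$-weakly convex with $\beta_i\ge0$. Let $S=\{x\in\mathbb{R}^{n-1}\mid g_i(x)\le0 \text{ for all } i\in\{2,\dots,m\}\}$ and assume that the problem of minimizing $F$ over $S$ has a solution. Let $(\rho,\eta)\in\,]0,+\infty[\,\times\mathbb{R}$ be such that $$D=\Big\{\widehat{x}\in\operatorname{Argmin}_{x\in S}F(x)\ \Big|\ F(\widehat{x})+\eta\ge\frac{\rho}{2}\|\widehat{x}\|^2\Big\}\neq\varnothing.$$ For every $i\in\{1,\dots,m\}$ and $y=(\overline{y},y_n)\in\mathbb{R}^{n-1}\times\mathbb{R}=\mathbb{R}^n$, let $$\widetilde{f}_i(y)=\begin{cases}F(\overline{y})+\eta-\frac{\rho}{2}\|y\|^2&\text{if } i=1,\\ g_i(\overline{y})&\text{otherwise.}\end{cases}$$ Then $\widehat{x}\in D$ if and only if there exists $\widehat{y}_n\in\mathbb{R}$ such that $\widehat{y}=(\widehat{x},\widehat{y}_n)$ is a solution to the problem $$\text{minimize}_{y\in\mathbb{R}^n}\ \|y\|^2\quad\text{subject to}\quad \widetilde{f}_i(y)\le0\ \text{ for all } i\in\{1,\dots,m\}.$$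
   Context: A function $f$ is $\beta$-weakly convex ($\beta\ge0$) if $f+\frac{\beta}{2}\|\cdot\|^2$ is convex. $\|\cdot\|$ is the Euclidean norm. ''Solution'' means global minimizer. *)

(* Defs.v *)
From mathcomp Require Import all_boot all_order all_algebra.
From mathcomp Require Import all_classical all_reals all_analysis.

Set Implicit Arguments.
Unset Strict Implicit.
Unset Printing Implicit Defensive.

Import Order.TTheory GRing.Theory Num.Theory.
Import numFieldNormedType.Exports.

Local Open Scope classical_set_scope.
Local Open Scope ring_scope.

(* The library's norm `|x| on row vectors is the sup norm. *)
Definition enorm (R : realType) (k : nat) (x : 'rV[R]_k) : R :=
  Num.sqrt (\sum_(j < k) x ord0 j ^+ 2).

Definition proper_function (R : realType) (T : Type) (f : T -> \bar R) : Prop :=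
  (forall x, f x != -oo%E) /\ (exists x, (f x < +oo)%E).

(* The endpoints t = 0, 1 are trivial and left out, so that no product 0 * oo
   arises. Meaningful for functions that never take the value -oo. *)
Definition econvex (R : realType) (k : nat) (f : 'rV[R]_k -> \bar R) : Prop :=
  forall (x y : 'rV[R]_k) (t : R), 0 < t -> t < 1 ->
    (f (t *: x + (1 - t) *: y)%R <= t%:E * f x + (1 - t)%:E * f y)%E.

Definition weakly_convex (R : realType) (k : nat) (beta : R)
    (f : 'rV[R]_k -> \bar R) : Prop :=
  econvex (fun x => f x + (beta / 2 * enorm x ^+ 2)%:E)%E.

(* Global minimizers of f over C. As usual for extended-valued objectives,
   a minimizer lies in the effective domain of f: if f is identically +oo
   on C, then there is none. *)
Definition argmin (R : realType) (T : Type) (C : set T) (f : T -> \bar R)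
    : set T :=
  [set x | [/\ C x, (f x < +oo)%E & forall z, C z -> (f x <= f z)%E]].

Definition feasible (R : realType) (T : Type) (a b : nat)
    (h : nat -> T -> \bar R) : set T :=
  [set x | forall i : nat, (a <= i <= b)%N -> (h i x <= 0)%E].

Definition minimizersD (R : realType) (k : nat) (S : set 'rV[R]_k)
    (F : 'rV[R]_k -> \bar R) (rho eta : R) : set 'rV[R]_k :=
  [set x | argmin S F x /\
           ((rho / 2 * enorm x ^+ 2)%:E <= F x + eta%:E)%E].

(* A point y = (ybar, y_n) of R^k x R = R^(k+1) has lsubmx y = ybar. *)
Definition ftilde (R : realType) (k : nat) (F : 'rV[R]_k -> \bar R)
    (g : nat -> 'rV[R]_k -> \bar R) (rho eta : R)
    (i : nat) (y : 'rV[R]_(k + 1)) : \bar R :=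
  if i == 1%N then (F (lsubmx y) + eta%:E - (rho / 2 * enorm y ^+ 2)%:E)%E
  else g i (lsubmx y).

(* Main.v *)
(* Write p for the minimum of F over S. A feasible y = (x, t) has x in S, hence
   rho/2 |y|^2 >= F x + eta >= p + eta. Equality is attained above every point
   of D by solving |x|^2 + t^2 = 2/rho (p + eta) for t, so D being nonempty makes
   2/rho (p + eta) the optimal value; conversely, at an optimal (x, t) the chain
   collapses, which gives F x = p and rho/2 |x|^2 <= rho/2 |y|^2 = p + eta. *)
Require Import Defs.
From mathcomp Require Import all_boot all_order all_algebra.
From mathcomp Require Import all_classical all_reals all_analysis.
From mathcomp Require Import ring.

Set Implicit Arguments.
Unset Strict Implicit.
Unset Printing Implicit Defensive.

Import Order.TTheory GRing.Theory Num.Theory.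
Import numFieldNormedType.Exports.

Local Open Scope classical_set_scope.
Local Open Scope ring_scope.

Lemma enorm_row_mx (R : realType) (k : nat) (x : 'rV[R]_k) (t : R) :
  enorm (row_mx x (const_mx t) : 'rV[R]_(k + 1)) ^+ 2 = enorm x ^+ 2 + t ^+ 2.
Proof.
have sum_ge0 l (z : 'rV[R]_l) : 0 <= \sum_(j < l) z ord0 j ^+ 2.
  by apply: sumr_ge0 => j _; exact: sqr_ge0.
rewrite /enorm !sqr_sqrtr// big_split_ord/= big_ord1 row_mxEr mxE.
by congr (_ + _); apply: eq_bigr => j _; rewrite row_mxEl.
Qed.

(** Only finite terms move across the inequality, so the equivalence survives infinite values of
    [F]: both sides fail at [+oo] and both hold at [-oo]. *)
Lemma ftilde1_le0 (R : realType) (k : nat) (F : 'rV[R]_k -> \bar R)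
    (g : nat -> 'rV[R]_k -> \bar R) (rho eta : R) (y : 'rV[R]_(k + 1)) :
  (ftilde F g rho eta 1 y <= 0)%E =
  (F (lsubmx y) <= (rho / 2 * enorm y ^+ 2 - eta)%:E)%E.
Proof.
rewrite /ftilde eqxx; case: (F (lsubmx y)) => [r| |] //=.
  by rewrite !lee_fin subr_le0 lerBrDr.
by rewrite !leNye.
Qed.

(** Index 1 carries the only constraint that involves the last coordinate; [1 <= m] guarantees that
    it is among those imposed. *)
Lemma feasible_ftilde (R : realType) (k m : nat) (F : 'rV[R]_k -> \bar R)
    (g : nat -> 'rV[R]_k -> \bar R) (rho eta : R) (y : 'rV[R]_(k + 1)) :
  (1 <= m)%N ->
  feasible 1 m (ftilde F g rho eta) y <->
  feasible 2 m g (lsubmx y) /\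
  (F (lsubmx y) <= (rho / 2 * enorm y ^+ 2 - eta)%:E)%E.
Proof.
move=> m_gt0; rewrite -(ftilde1_le0 F g); split=> [fy|[gy Fy] i /andP[i1 im]].
  split=> [i /andP[i2 im]|]; last exact: fy.
  have := fy i; rewrite /ftilde gtn_eqF//; apply.
  by rewrite (ltnW i2).
have [->//|i_neq1] := eqVneq i 1%N.
by rewrite /ftilde (negbTE i_neq1); apply: gy; rewrite im ltn_neqAle eq_sym i_neq1 i1.
Qed.

Lemma argmin_fin (R : realType) (T : Type) (C : set T) (f : T -> \bar R) (x : T) :
  proper_function f -> argmin C f x -> exists p : R, f x = p%:E.
Proof.
by move=> [fNy _] [_ fx _]; exists (fine (f x)); rewrite fineK// fin_numE fNy lt_eqF.
Qed.

(** Serves both directions of the theorem: lifting [xhat] itself gives the solution sought, and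
    lifting some point of [D] gives a competitor. *)
Lemma minimizersD_lift (R : realType) (k m : nat) (F : 'rV[R]_k -> \bar R)
    (g : nat -> 'rV[R]_k -> \bar R) (rho eta p : R) (x : 'rV[R]_k) :
  (1 <= m)%N -> 0 < rho -> F x = p%:E ->
  minimizersD (feasible 2 m g) F rho eta x ->
  exists t : R, let y : 'rV[R]_(k + 1) := row_mx x (const_mx t) in
    feasible 1 m (ftilde F g rho eta) y /\ rho / 2 * enorm y ^+ 2 = p + eta.
Proof.
move=> m_gt0 rho_gt0 Fx [[Sx _ _]]; rewrite Fx -EFinD lee_fin => x_le.
exists (Num.sqrt (2 / rho * (p + eta) - enorm x ^+ 2)) => y.
have yE : rho / 2 * enorm y ^+ 2 = p + eta.
  rewrite enorm_row_mx [in X in _ + X]sqr_sqrtr; first by field; rewrite gt_eqF.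
  (* [Num.sqrt] vanishes on negative reals, so the radicand has to be nonnegative; factoring out
     [2 / rho] reduces this to [x_le], the inequality that defines [D]. *)
  have -> : 2 / rho * (p + eta) - enorm x ^+ 2 =
            2 / rho * (p + eta - rho / 2 * enorm x ^+ 2).
    by field; rewrite gt_eqF.
  by rewrite mulr_ge0 ?subr_ge0// divr_ge0// ltW.
(* The first constraint is active at [y]: its bound on [F x] is exactly [p]. *)
by split=> //; apply/feasible_ftilde => //; rewrite row_mxKl yE addrK Fx.
Qed.

Theorem theorem2p1 (R : realType) (n m : nat) (hn : (2 <= n)%N) (hm : (1 <= m)%N)
    (beta : nat -> R)
    (F : 'rV[R]_(n.-1) -> \bar R)
    (g : nat -> 'rV[R]_(n.-1) -> \bar R)
    (F_proper : proper_function F)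
    (F_lsc : lower_semicontinuous F)
    (beta1_ge0 : 0 <= beta 1%N)
    (F_wconvex : weakly_convex (beta 1%N) F)
    (g_proper : forall i : nat, (2 <= i <= m)%N -> proper_function (g i))
    (g_lsc : forall i : nat, (2 <= i <= m)%N -> lower_semicontinuous (g i))
    (beta_ge0 : forall i : nat, (2 <= i <= m)%N -> 0 <= beta i)
    (g_wconvex : forall i : nat, (2 <= i <= m)%N -> weakly_convex (beta i) (g i))
    (S : set 'rV[R]_(n.-1))
    (S_def : S = feasible 2 m g)
    (F_sol : argmin S F !=set0)
    (rho eta : R) (rho_gt0 : 0 < rho)
    (D : set 'rV[R]_(n.-1))
    (D_def : D = minimizersD S F rho eta)
    (D_neq0 : D !=set0)
    (xhat : 'rV[R]_(n.-1)) :
  D xhat <->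
  exists yn : R,
    argmin (feasible 1 m (ftilde F g rho eta))
           (fun y : 'rV[R]_(n.-1 + 1) => (enorm y ^+ 2)%:E)
           (row_mx xhat (const_mx yn)).
Proof.
subst S D; split.
  move=> Dx; have [xmin _] := Dx.
  have [p Fx] := argmin_fin F_proper xmin.
  have [t [y_feas yE]] := minimizersD_lift hm rho_gt0 Fx Dx.
  exists t; split=> //; first exact: ltry.
  move=> z /(feasible_ftilde _ _ _ _ _ hm)[Sz Fz].
  have [_ _ /(_ _ Sz) Fxz] := xmin.
  have := le_trans Fxz Fz; rewrite Fx !lee_fin lerBrDr -yE ler_pM2l//.
  by rewrite divr_gt0.
move=> [t [/(feasible_ftilde _ _ _ _ _ hm)[]]].
rewrite row_mxKl => Sx Fx _ ymin.
(* Nothing yet bounds the norm of the given solution from above; the lift of a point of [D] does, by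
   optimality. *)
have [x0 Dx0] := D_neq0; have [x0min _] := Dx0.
have [p Fx0] := argmin_fin F_proper x0min.
have [t0 [y0_feas y0E]] := minimizersD_lift hm rho_gt0 Fx0 Dx0.
have := ymin _ y0_feas; rewrite lee_fin => y_le.
have {}y_le : rho / 2 * enorm (row_mx xhat (const_mx t) : 'rV[R]_(n.-1 + 1)) ^+ 2
    <= p + eta.
  by rewrite -y0E ler_pM2l// divr_gt0.
(* The first constraint bounds [F xhat] by [rho / 2 |y|^2 - eta], which [y_le] bounds by [p]. *)
have Fx_le : (F xhat <= p%:E)%E.
  by apply: le_trans Fx _; rewrite lee_fin lerBlDr.
have [_ _ Fmin] := x0min.
have FxE : F xhat = p%:E by apply/eqP; rewrite eq_le Fx_le -Fx0 Fmin.
split; first by split=> [//||z Sz]; rewrite FxE ?ltry// -Fx0; exact: Fmin.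
(* Discarding [t ^+ 2] from the squared norm turns [y_le] into the inequality that defines [D]. *)
rewrite FxE -EFinD lee_fin; apply: le_trans y_le.
by rewrite enorm_row_mx ler_pM2l ?divr_gt0// lerDl sqr_ge0.
Qed.
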